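(* Let $R$ be a principal ideal domain in which each maximal ideal has finite index. Let $n\geq 2$ and let $f,g\in R[X]$ be monic polynomials of degree $n$ with companion matrices $C,D\in M_n(R)$, respectively. Then $R\langle C,D\rangle$ has maximal rank in $M_n(R)$ (i.e. it is a free $R$-module of rank $n^2$) if and only if the resultant $R(f,g)\neq 0$, in which case $$[M_n(R):R\langle C,D\rangle]=N(R(f,g))^{n-1}.$$
   Context: The companion matrix of a monic polynomial $f=f_0+f_1X+\cdots+f_{n-1}X^{n-1}+X^n\in R[X]$ is the matrix in $M_n(R)$ whose $j$-th column is $e_{j+1}$ for $1\leq j\leq n-1$ and whose last column is $(-f_0,-f_1,\dots,-f_{n-1})^t$, where $e_1,\dots,e_n$ is the canonical basis of the column space $R^n$. $R\langle C,D\rangle$ denotes the (unital) $R$-subalgebra of $M_n(R)$ generated by $C$ and $D$. $R(f,g)\in R$ denotes the resultant of $f$ and $g$. Under the hypothesis on $R$, every non-zero ideal $Ra$ of $R$ has finite index in $R$; this index $[R:Ra]$ is denoted $N(a)$ (for instance $N(a)=|a|$ when $R=\mathbb Z$). $[M_n(R):R\langle C,D\rangle]$ is the index as additive groups. *)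

(* Defs.v *)
From mathcomp Require Import all_boot all_order all_algebra.
From mathcomp Require Import finmap.
From mathcomp Require Import all_classical.

Set Implicit Arguments.
Unset Strict Implicit.
Unset Printing Implicit Defensive.

Import GRing.Theory.
Local Open Scope classical_set_scope.
Local Open Scope ring_scope.

Definition ideal (R : idomainType) (I : set R) : Prop :=
  [/\ I 0,
      forall x y, I x -> I y -> I (x + y) &
      forall a x, I x -> I (a * x)].

Definition principal_ideal (R : idomainType) (a : R) : set R :=
  [set r * a | r in [set: R]].

Definition is_pid (R : idomainType) : Prop :=
  forall I : set R, ideal I -> exists a : R, I = principal_ideal a.

Definition maximal_ideal (R : idomainType) (I : set R) : Prop :=
  [/\ ideal I, I <> setT &
      forall J : set R, ideal J -> I `<=` J -> J = I \/ J = setT].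

Definition cosets (V : zmodType) (H : set V) : set (set V) :=
  range (fun v : V => [set v + h | h in H]).

Definition finite_index (V : zmodType) (H : set V) : Prop :=
  finite_set (cosets H).

(* [fset_set] sends an infinite set to the empty one, so an infinite index is
   encoded as 0; a finite index is always positive. *)
Definition add_index (V : zmodType) (H : set V) : nat :=
  #|` fset_set (cosets H)|%fset.

Definition ideal_norm (R : idomainType) (a : R) : nat :=
  add_index (principal_ideal a).

(* The library's [companionmx] is the transpose of this matrix, with dimension
   [(size f).-1] instead of [n]. *)
Definition companion (R : idomainType) (n : nat) (f : {poly R}) : 'M[R]_n :=
  \matrix_(i < n, j < n)
    if j.+1 == n then - f`_i else (i == j.+1 :> nat)%:R.

(* [GRing.subalg_closed] does not apply: ['M[R]_n] has a canonical [lalgType]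
   structure only when [n] is syntactically a successor. *)
Definition matrix_subalgebra (R : idomainType) (n : nat) (S : set 'M[R]_n) :
  Prop :=
  [/\ S 1%:M,
      forall (a : R) A B, S A -> S B -> S (a *: A + B) &
      forall A B, S A -> S B -> S (A *m B)].

Definition generated_subalgebra (R : idomainType) (n : nat) (C D : 'M[R]_n) :
  set 'M[R]_n :=
  smallest (@matrix_subalgebra R n) [set C; D].

Definition free_of_rank (R : idomainType) (V : lmodType R) (S : set V)
  (k : nat) : Prop :=
  exists b : 'I_k -> V,
    S = [set \sum_(i < k) c 0 i *: b i | c in [set: 'rV[R]_k]] /\
    (forall c : 'rV[R]_k, \sum_(i < k) c 0 i *: b i = 0 -> c = 0).

(* Main.v *)
(* Let n be the common degree and h = g - f, and let C be the companion matrix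
   of f, so that h(C) = g(C). The difference C - D is h(C) times the matrix unit
   in position (1, n), and multiplying it by powers of C on both sides gives
   h(C) times every matrix unit, so that R<C, D> = R[C] + h(C) M_n(R). As e_1 is
   a cyclic vector of C, each matrix A has the same first column as exactly one
   element p_A(C) of R[C], and A lies in R<C, D> iff A - p_A(C) lies in
   h(C) M_n(R). The remaining n - 1 columns then identify M_n(R) / R<C, D> with
   (R^n / h(C) R^n)^(n-1), and R^n / h(C) R^n has N(det h(C)) elements by column
   reduction over a principal ideal domain, while det h(C) is associated to the
   resultant of f and g. *)

From HB Require Import structures.
Require Import Defs.
From mathcomp Require Import all_boot all_order all_algebra.
From mathcomp Require Import finmap.
From mathcomp Require Import all_classical.
From mathcomp Require Import ring zify.

Set Implicit Arguments.
Unset Strict Implicit.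
Unset Printing Implicit Defensive.

Import GRing.Theory.
Local Open Scope classical_set_scope.
Local Open Scope ring_scope.

(** * Finite quotients of abelian groups *)

(** A model of V / H on a finite type: the fibres of [phi] are the cosets of [H]. It is a model of
    sets only, with no group law on [T], so that models can be multiplied along extensions. *)
Definition is_quotient_by (V : zmodType) (H : set V) (T : finType)
    (phi : V -> T) : Prop :=
  (forall t, exists v, phi v = t) /\
  (forall x y, phi x = phi y <-> H (x - y)).

Definition subgroup (V : zmodType) (H : set V) : Prop :=
  H 0 /\ (forall x y, H x -> H y -> H (x - y)).

Lemma eq_coset (V : zmodType) (H : set V) (x y : V) : subgroup H ->
  [set x + h | h in H] = [set y + h | h in H] <-> H (x - y).
Proof.
move=> [H0 HB].
have HN z : H z -> H (- z) by move=> Hz; rewrite -sub0r; exact: HB.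
have HD z t : H z -> H t -> H (z + t).
  by move=> Hz Ht; rewrite -[t]opprK; apply: HB => //; exact: HN.
split=> [e|Hxy].
  have : [set y + h | h in H] x by rewrite -e; exists 0; rewrite ?addr0.
  by move=> [h Hh <-]; rewrite addrC addKr.
apply/seteqP; split=> _ [h Hh <-].
  by exists (x - y + h); [exact: HD | rewrite addrA [y + _]addrC subrK].
exists (h - (x - y)); first exact: HB.
by rewrite opprB addrCA [x + _]addrC subrK addrC.
Qed.

Lemma quotient_index (V : zmodType) (H : set V) (T : finType) (phi : V -> T) :
  subgroup H -> is_quotient_by H phi ->
  finite_index H /\ add_index H = #|T|.
Proof.
move=> sgH [phi_surj phi_eq].
have [s sK] : exists s : T -> V, cancel s phi.
  by exists (fun t => projT1 (cid (phi_surj t))) => t; case: cid.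
pose c (t : T) := [set s t + h | h in H].
have c_inj : injective c.
  by move=> t u /eq_coset-/(_ sgH)/phi_eq; rewrite !sK.
have cosetsE : cosets H = range c.
  apply/seteqP; split=> _ [v _ <-]; last by exists (s v).
  by exists (phi v) => //; apply/eq_coset => //; apply/phi_eq; rewrite sK.
have fT : finite_set [set: T] by exact: finite_finset.
split; first by rewrite /finite_index cosetsE; exact: finite_image.
rewrite /add_index cosetsE fset_set_image // card_imfset //=.
rewrite cardE; apply: perm_size; apply: uniq_perm.
- exact: fset_uniq.
- exact: enum_uniq.
by move=> t; rewrite mem_enum in_fset_set // in_setT.
Qed.

Lemma finite_index_quotient (V : zmodType) (H : set V) :
  subgroup H -> finite_index H ->
  exists (T : finType) (phi : V -> T), is_quotient_by H phi.
Proof.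
move=> sgH finH; pose S := fset_set (cosets H).
have inS v : [set v + h | h in H] \in S.
  by rewrite in_fset_set // inE; exists v.
exists S, (fun v => [` inS v]%fset); split.
  move=> [A AS]; have : A \in cosets H by rewrite -in_fset_set.
  rewrite inE => -[v _ Av].
  by exists v; apply/val_inj.
move=> x y; rewrite -eq_coset //; split=> [[]//|e].
exact/val_inj.
Qed.

(* The quotient of [V] by [alpha K] is an extension of [V / alpha W] by
   [W / K]; a section [s] of [phi] identifies it with the product as a set. *)
Lemma quotient_comp (V W : zmodType) (alpha : W -> V) (K : set W)
    (T1 T2 : finType) (phi : V -> T1) (psi : W -> T2) :
  {morph alpha : x y / x - y} -> injective alpha ->
  is_quotient_by (range alpha) phi -> is_quotient_by K psi ->
  exists theta : V -> T1 * T2, is_quotient_by [set alpha w | w in K] theta.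
Proof.
move=> alphaB alpha_inj [phi_surj phi_eq] [psi_surj psi_eq].
have [s sK] : exists s : T1 -> V, cancel s phi.
  by exists (fun t => projT1 (cid (phi_surj t))) => t; case: cid.
have [r rE] : exists r : V -> W, forall v, alpha (r v) = v - s (phi v).
  have h v : exists w, alpha w = v - s (phi v).
    have /phi_eq [w _ <-] : phi v = phi (s (phi v)) by rewrite sK.
    by exists w.
  by exists (fun v => projT1 (cid (h v))) => v; case: cid.
exists (fun v => (phi v, psi (r v))); split.
  move=> [t1 t2]; have [w <-] := psi_surj t2.
  have phiE : phi (s t1 + alpha w) = t1.
    by rewrite -[RHS]sK; apply/phi_eq; exists w => //; rewrite addrC addKr.
  exists (s t1 + alpha w); rewrite phiE; congr (_, psi _).
  by apply: alpha_inj; rewrite rE phiE addrC addKr.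
move=> x y; split=> [[exy /psi_eq Kxy]|[w Kw ew]].
  by exists (r x - r y) => //; rewrite alphaB !rE exy opprB addrA subrK.
have exy : phi x = phi y by apply/phi_eq; exists w.
rewrite exy; congr (_, _); apply/psi_eq.
suff -> : r x - r y = w by [].
by apply: alpha_inj; rewrite alphaB !rE exy opprB addrA subrK ew.
Qed.

Lemma is_quotient_byW (V : zmodType) (H H' : set V) (T : finType)
    (phi : V -> T) :
  H = H' -> is_quotient_by H phi -> is_quotient_by H' phi.
Proof. by move=> ->. Qed.

(** * Finiteness of R / Ra over a principal ideal domain *)

Section Ideals.
Variable R : idomainType.

Lemma principal_ideal_ideal (a : R) : ideal (principal_ideal a).
Proof.
split; first by exists 0; rewrite ?mul0r.
- by move=> _ _ [x _ <-] [y _ <-]; exists (x + y); rewrite ?mulrDl.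
- by move=> b _ [x _ <-]; exists (b * x); rewrite ?mulrA.
Qed.

Lemma ideal_subgroup (I : set R) : ideal I -> subgroup I.
Proof.
move=> [I0 ID IM]; split=> // x y Ix Iy.
by apply: ID => //; rewrite -mulN1r; apply: IM.
Qed.

Lemma principal_ideal_sub (a b : R) :
  principal_ideal a `<=` principal_ideal b <-> exists r, a = r * b.
Proof.
split=> [ab|[r ->] _ [s _ <-]]; last by exists (s * r); rewrite ?mulrA.
have [r _ <-] : principal_ideal b a by apply: ab; exists 1; rewrite ?mul1r.
by exists r.
Qed.

Lemma principal_ideal_unit (a u : R) : u \is a GRing.unit ->
  principal_ideal (a * u) = principal_ideal a.
Proof.
move=> uU; apply/seteqP; split; apply/principal_ideal_sub.
  by exists u; rewrite mulrC.
by exists u^-1; rewrite mulrC mulrK.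
Qed.

(** Multiplication by [a] is injective and carries Rb onto Rba, so R / Rba is an extension of R / Ra
    by R / Rb. *)
Lemma quotient_mul (a b : R) (T1 T2 : finType) (phi : R -> T1) (psi : R -> T2) :
  a != 0 ->
  is_quotient_by (principal_ideal a) phi ->
  is_quotient_by (principal_ideal b) psi ->
  exists theta : R -> T1 * T2, is_quotient_by (principal_ideal (b * a)) theta.
Proof.
move=> a0 qa qb.
have qa' : is_quotient_by (range ( *%R a)) phi.
  by apply: is_quotient_byW qa; apply: eq_imagel => x _ /=; exact: mulrC.
have [theta q] := quotient_comp (mulrBr a) (mulfI a0) qa' qb.
exists theta; apply: is_quotient_byW q.
rewrite /principal_ideal image_comp; apply: eq_imagel => x _ /=.
by rewrite mulrC mulrA.
Qed.

Hypothesis R_pid : is_pid R.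

(** The Noetherian property: otherwise choice yields a strictly ascending chain of principal ideals.
    Its union is principal, and the chain stops at the first member containing a generator. *)
Lemma pid_maximal (P : R -> Prop) (a : R) : P a ->
  exists b, P b /\
    forall c, P c -> principal_ideal b `<=` principal_ideal c ->
              principal_ideal c = principal_ideal b.
Proof.
move=> Pa; apply: contrapT => nomax.
have step (x : {x | P x}) : exists y : {y | P y},
    principal_ideal (sval x) `<=` principal_ideal (sval y) /\
    principal_ideal (sval y) <> principal_ideal (sval x).
  apply: contrapT => nx; apply: nomax; exists (sval x).
  split=> [|c Pc xc]; first exact: (svalP x).
  by apply: contrapT => ne; apply: nx; exists (exist _ c Pc).
pose next x := projT1 (cid (step x)).
pose u k := iter k next (exist _ a Pa).
pose I k := principal_ideal (sval (u k)).
have I_step k : I k `<=` I k.+1 /\ I k.+1 <> I k.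
  by rewrite /I /u iterS /next; case: cid.
have I_mono j k : (j <= k)%N -> I j `<=` I k.
  elim: k => [|k IHk]; first by rewrite leqn0 => /eqP ->.
  rewrite leq_eqVlt => /predU1P[->//|/IHk jk].
  by move=> x /jk; apply: (I_step k).1.
have idU : ideal (\bigcup_k I k).
  split; first by exists 0%N => //;
    case: (principal_ideal_ideal (sval (u 0%N))).
  - move=> x y [j _ Ix] [k _ Iy]; exists (maxn j k) => //.
    have [_ ID _] := principal_ideal_ideal (sval (u (maxn j k))).
    by apply: ID; [apply: I_mono Ix; rewrite leq_maxl
                  |apply: I_mono Iy; rewrite leq_maxr].
  - move=> r x [k _ Ix]; exists k => //.
    by have [_ _ IM] := principal_ideal_ideal (sval (u k)); apply: IM.
have [c cE] := R_pid idU.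
have [k _ Ick] : (\bigcup_k I k) c by rewrite cE; exists 1; rewrite ?mul1r.
apply: (I_step k).2; apply/seteqP; split; last exact: (I_step k).1.
move=> x Ix; have : (\bigcup_k I k) x by exists k.+1.
rewrite cE => -[r _ <-].
by have [_ _ IM] := principal_ideal_ideal (sval (u k)); apply: IM.
Qed.

(** Noetherian induction: take Rb maximal among the bad ideals. If b = r c, then [c] or [r] is bad
    by [quotient_mul], so Rc = Rb, or Rr = Rb and [c] is a unit. Hence Rb is a maximal ideal, of
    finite index after all. *)
Lemma pid_finite_quotient (a : R) :
  (forall I : set R, maximal_ideal I -> finite_index I) -> a != 0 ->
  exists (T : finType) (phi : R -> T), is_quotient_by (principal_ideal a) phi.
Proof.
move=> max_fin a0; apply: contrapT => bad_a.
pose bad b := b != 0 /\ ~ exists (T : finType) (phi : R -> T),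
  is_quotient_by (principal_ideal b) phi.
have [b [[b0 bad_b] b_max]] := @pid_maximal bad a (conj a0 bad_a).
have good_unit : principal_ideal b <> setT.
  move=> bT; apply: bad_b; exists unit, (fun=> tt); split.
    by case; exists 0.
  by move=> x y; rewrite bT.
apply: (bad_b); apply: finite_index_quotient.
  exact/ideal_subgroup/principal_ideal_ideal.
apply: max_fin; split=> // [|J /R_pid[c ->] bc].
  exact: principal_ideal_ideal.
have [r br] := (principal_ideal_sub _ _).1 bc.
have [r0 c0] : r != 0 /\ c != 0.
  by apply/andP; rewrite -negb_or -mulf_eq0 -br.
have [[T1 [phi qc]]|bad_c] := pselect (exists (T : finType) (phi : R -> T),
    is_quotient_by (principal_ideal c) phi); last by left; apply: b_max.
have [[T2 [psi qr]]|bad_r] := pselect (exists (T : finType) (phi : R -> T),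
    is_quotient_by (principal_ideal r) phi).
  have [theta q] := quotient_mul c0 qc qr.
  by case: bad_b; exists (T1 * T2)%type, theta; rewrite br.
right; have rb : principal_ideal r = principal_ideal b.
  by apply: b_max => //; apply/principal_ideal_sub; exists c; rewrite br mulrC.
have [s rs] : exists s, r = s * b by apply/principal_ideal_sub; rewrite rb.
have sc1 : s * c = 1.
  by apply: (mulfI r0); rewrite mulr1 {2}rs br mulrCA.
by apply/seteqP; split=> // x _; exists (x * s) => //; rewrite -mulrA sc1 mulr1.
Qed.
End Ideals.

(** * Column reduction and the index of the image of a matrix *)

Section PidMatrices.
Variable R : idomainType.
Hypothesis R_pid : is_pid R.

(** The last identity says that the matrix with rows (u, -c') and (v, a') has determinant 1; it
    sends the row (a, c) to (d, 0). *)
Lemma pid_bezout (a c : R) : exists d u v a' c',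
  [/\ d = u * a + v * c, a = a' * d, c = c' * d & u * a' + v * c' = 1].
Proof.
(* A non-zero [a] makes [d] non-zero, hence cancellable in the last identity; for a = 0 the
   generator may vanish, so the coefficients are given by hand. *)
have [a0|a0] := eqVneq a 0.
  by exists c, 0, 1, 0, 1; rewrite a0; split; ring.
pose I : set R := [set u * a + v * c | u in setT & v in setT].
have idI : ideal I.
  split; first by exists 0 => //; exists 0 => //; ring.
  - move=> _ _ [u _ [v _ <-]] [u' _ [v' _ <-]].
    by exists (u + u') => //; exists (v + v') => //; ring.
  - move=> b _ [u _ [v _ <-]].
    by exists (b * u) => //; exists (b * v) => //; ring.
have [d dE] := R_pid idI.
have [u _ [v _ duv]] : I d by rewrite dE; exists 1; rewrite ?mul1r.
have [a' _ ad] : principal_ideal d a.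
  by rewrite -dE; exists 1 => //; exists 0 => //; ring.
have [c' _ cd] : principal_ideal d c.
  by rewrite -dE; exists 0 => //; exists 1 => //; ring.
exists d, u, v, a', c'; split=> //.
have d0 : d != 0 by apply: contra_neq a0 => d0; rewrite -ad d0 mulr0.
by apply: (mulIf d0); rewrite mulrDl -!mulrA ad cd duv mul1r.
Qed.

Lemma pid_row_reduction n (r : 'rV[R]_(1 + n)) :
  exists (U : 'M[R]_(1 + n)) (d : R),
    U \in unitmx /\ r *m U = row_mx d%:M (0 : 'rV_n).
Proof.
elim: n r => [|n IHn] r.
  exists 1%:M, (r 0 0); rewrite unitmx1 mulmx1; split=> //.
  apply/matrixP=> i j; rewrite ord1 [RHS]mxE.
  by case: splitP => [k _|[]] //; rewrite !ord1 mxE.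
have [U [c [U_unit rU]]] := IHn (rsubmx r).
have [d [u [v [a' [c' [dE aE cE uv1]]]]]] := pid_bezout (r 0 0) c.
(* The Bezout matrix of determinant 1 on the first two coordinates and the identity elsewhere; [W']
   is its inverse. *)
pose W : 'M[R]_(1 + (1 + n)) :=
  block_mx u%:M (row_mx (- c')%:M 0) (col_mx v%:M 0) (block_mx a'%:M 0 0 1%:M).
pose W' : 'M[R]_(1 + (1 + n)) :=
  block_mx a'%:M (row_mx c'%:M 0) (col_mx (- v)%:M 0) (block_mx u%:M 0 0 1%:M).
pose U1 : 'M[R]_(1 + (1 + n)) := block_mx 1%:M 0 0 U.
have W_unit : W \in unitmx.
  suff /mulmx1_unit[] : W *m W' = 1%:M by [].
  rewrite /W /W' mulmx_block mul_row_col mul_mx_row mul_row_block mul_col_mx.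
  rewrite mul_block_col mul_col_row mulmx_block.
  rewrite !(mul_scalar_mx, mul_mx_scalar, mulmx0, mul0mx, scale_scalar_mx).
  rewrite !(scaler0, addr0, add0r, scale1r,
    add_row_mx, add_col_mx, add_block_mx).
  have scD (x y z : R) : x + y = z -> x%:M + y%:M = z%:M :> 'M_1.
    by move=> <-; rewrite raddfD.
  rewrite (scD _ _ 1); last by rewrite -[RHS]uv1; ring.
  rewrite (scD _ _ 0); last by ring.
  rewrite (scD _ _ 0); last by ring.
  rewrite (scD _ _ 1); last by rewrite -[RHS]uv1; ring.
  by rewrite mulr1 !raddf0 row_mx0 col_mx0 -block_mxEv -!scalar_mx_block.
exists (U1 *m W), d; split.
  by rewrite unitmx_mul W_unit andbT unitmxE det_ublock det1 mul1r -unitmxE.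
have lr : lsubmx r = (r 0 0)%:M.
  rewrite [LHS]mx11_scalar mxE; congr (r _ _)%:M; exact/val_inj.
have row_mulW :
    row_mx (r 0 0)%:M (row_mx c%:M (0 : 'rV_n)) *m W = row_mx d%:M 0.
  rewrite /W mul_row_block mul_row_col mul_mx_row mul_row_block add_row_mx.
  rewrite !(mul_scalar_mx, mulmx0, mul0mx, scale_scalar_mx, scaler0, addr0).
  rewrite -!raddfD /= mulrC [c * v]mulrC -dE.
  have -> : r 0 0 * - c' + c * a' = 0 by rewrite aE cE; ring.
  by rewrite raddf0 row_mx0.
rewrite mulmxA -[r]hsubmxK /U1 mul_row_block mulmx1 !mulmx0 addr0 add0r rU lr.
exact: row_mulW.
Qed.

(** The shared [T] expresses that both quotients have equally many elements. By induction on [n]: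
    reducing the first row to (d, 0) leaves a block triangular matrix with diagonal blocks [d] and
    [H1], and both quotients become extensions with factors of sizes #|T1| and #|T2|. *)
Lemma quotient_range_mulmx n (H : 'M[R]_n) :
  (forall I : set R, maximal_ideal I -> finite_index I) -> \det H != 0 ->
  exists (T : finType) (phi : 'cV[R]_n -> T) (psi : R -> T),
    is_quotient_by (range (fun v => H *m v)) phi /\
    is_quotient_by (principal_ideal (\det H)) psi.
Proof.
move=> max_fin; elim: n H => [|n IHn] H.
  move=> _; exists unit, (fun=> tt), (fun=> tt); split; split.
  - by case; exists 0.
  - by move=> x y; split=> // _; exists 0 => //; apply/colP; case.
  - by case; exists 0.
  - by move=> x y; split=> // _; exists (x - y) => //; rewrite det_mx00 mulr1.
have [U [d [U_unit rU]]] := pid_row_reduction (usubmx (H : 'M_(1 + n))).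
pose L := (H : 'M_(1 + n)) *m U.
pose H1 : 'M_n := drsubmx L; pose c : 'cV_n := dlsubmx L.
have LE : L = block_mx d%:M 0 c H1.
  rewrite -[LHS]submxK; congr block_mx.
    by rewrite /ulsubmx /L -mul_usub_mx rU row_mxKl.
  by rewrite /ursubmx /L -mul_usub_mx rU row_mxKr.
have detL : \det L = \det H1 * d by rewrite LE det_lblock det_scalar1 mulrC.
have detU : \det U \is a GRing.unit by rewrite -unitmxE.
have detHU : \det L = \det H * \det U by rewrite det_mulmx.
move=> H0; have : \det L != 0.
  by rewrite detHU mulf_neq0 //; apply: contraTneq detU => ->; rewrite unitr0.
rewrite detL mulf_eq0 negb_or => /andP[H10 d0].
have rangeE : range (fun v : 'cV_(1 + n) => H *m v) =
              range (fun v : 'cV_(1 + n) => L *m v).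
  apply/seteqP; split=> _ [v _ <-].
    by exists (invmx U *m v) => //; rewrite /L -mulmxA mulKVmx.
  by exists (U *m v) => //; rewrite /L mulmxA.
have [T1 [phi1 q1]] := pid_finite_quotient R_pid max_fin d0.
have [T2 [phi2 [psi2 [q2 q2']]]] := IHn H1 H10.
have [psi qpsi] := quotient_mul d0 q1 q2'.
(* [L] is this matrix times [block_mx 1 0 0 H1]. Hence the range of [L] is the image under [alpha]
   of the set [K] below, while the range of [alpha] only constrains the first coordinate modulo
   [d]. *)
pose alpha (w : 'cV[R]_(1 + n)) := block_mx d%:M 0 c 1%:M *m w.
have alphaE w : alpha w = col_mx (d *: usubmx w) (c *m usubmx w + dsubmx w).
  rewrite /alpha -{1}[w]vsubmxK mul_block_col.
  by rewrite mul0mx addr0 mul1mx mul_scalar_mx.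
have alphaB : {morph alpha : x y / x - y} by move=> x y; exact: mulmxBr.
have alpha_inj : injective alpha.
  move=> x y; rewrite !alphaE => /eq_col_mx[/(scalemx_inj d0) u /eqP].
  by rewrite u (inj_eq (addrI _)) => /eqP e; rewrite -[x]vsubmxK u e vsubmxK.
pose pi1 (v : 'cV[R]_(1 + n)) := phi1 (v 0 0).
have qpi1 : is_quotient_by (range alpha) pi1.
  split=> [t|x y].
    by have [a <-] := q1.1 t; exists (const_mx a); rewrite /pi1 mxE.
  rewrite q1.2; split=> [[r _ e]|[w _ e]].
    exists (col_mx r%:M (dsubmx (x - y) - c *m r%:M)) => //.
    rewrite alphaE col_mxKu col_mxKd addrC subrK -[RHS]vsubmxK; congr col_mx.
    rewrite scale_scalar_mx mulrC e [RHS]mx11_scalar !mxE.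
    by congr ((x _ _ - y _ _)%:M); apply/val_inj.
  have : (x - y) 0 0 = alpha w 0 0 by rewrite e.
  rewrite alphaE !mxE => ->; case: splitP => // k _; exists (w 0 0) => //.
  by rewrite ord1 !mxE mulrC; congr (_ * w _ _); apply/val_inj.
pose K : set 'cV[R]_(1 + n) := [set w | range (fun v => H1 *m v) (dsubmx w)].
have qK : is_quotient_by K (fun w => phi2 (dsubmx w)).
  split=> [t|x y].
    by have [v <-] := q2.1 t; exists (col_mx 0 v); rewrite col_mxKd.
  by rewrite q2.2 /K /= raddfB.
have [phi qphi] := quotient_comp alphaB alpha_inj qpi1 qK.
exists (T1 * T2)%type, phi, psi; split.
  rewrite rangeE; apply: is_quotient_byW qphi.
  apply/seteqP; split=> x [w].
    move=> [v _ e] <-; exists (col_mx (usubmx w) v) => //.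
    rewrite alphaE -e LE mul_block_col mul0mx addr0 mul_scalar_mx //.
  move=> _ <-; exists (col_mx (usubmx w) (H1 *m dsubmx w)).
    by rewrite /K /= col_mxKd; exists (dsubmx w).
  rewrite alphaE col_mxKu col_mxKd LE -[in RHS](vsubmxK w) mul_block_col.
  by rewrite mul0mx addr0 mul_scalar_mx.
apply: is_quotient_byW qpsi.
by rewrite -detL detHU principal_ideal_unit.
Qed.

End PidMatrices.

(** * The companion matrix and its cyclic vector *)

Section Companion.
Variables (R : idomainType) (m : nat) (f : {poly R}).
Local Notation C := (companion m.+1 f).
Local Notation e0 := (delta_mx 0 0 : 'cV[R]_m.+1).

Lemma horner_mxC (p q : {poly R}) :
  horner_mx C p *m horner_mx C q = horner_mx C q *m horner_mx C p.
Proof. by rewrite mulmxE -!rmorphM mulrC. Qed.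

Lemma companion_expr_delta (i : 'I_m.+1) :
  (C ^+ i) *m e0 = delta_mx i 0.
Proof.
case: i => i /=; elim: i => [|i IHi] lt_i_m.
  by rewrite expr0 mul1mx; congr delta_mx; apply/val_inj.
rewrite exprS -mulmxE -mulmxA (IHi (ltnW lt_i_m)) -colE.
apply/colP=> k; rewrite !mxE /= andbT.
by rewrite ltn_eqF // eq_sym -val_eqE eq_sym.
Qed.

(** Polynomials in [C] commute, and [C ^+ i] moves [e0] to the i-th basis vector; thus the first
    column of p(C) determines all the others. *)
Lemma horner_companion_delta p (i : 'I_m.+1) :
  horner_mx C p *m delta_mx i 0 = C ^+ i *m (horner_mx C p *m e0).
Proof.
have -> : C ^+ i = horner_mx C 'X^i by rewrite rmorphXn /= horner_mx_X.
rewrite mulmxA horner_mxC -mulmxA rmorphXn /= horner_mx_X.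
by rewrite companion_expr_delta.
Qed.

(* [e0] is a cyclic vector. *)
Lemma horner_companion_eq0 p :
  horner_mx C p *m e0 = 0 -> horner_mx C p = 0.
Proof.
move=> p0; apply/matrixP=> i j.
have := horner_companion_delta p j; rewrite p0 mulmx0 -colE => /colP/(_ i).
by rewrite !mxE.
Qed.

Lemma horner_rVpoly_e0 (v : 'cV[R]_m.+1) :
  horner_mx C (rVpoly v^T) *m e0 = v.
Proof.
rewrite [X in rVpoly X]row_sum_delta !linear_sum mulmx_suml /=.
rewrite [RHS]matrix_sum_delta; apply: eq_bigr => i _.
rewrite big_ord1 2!linearZ /= rVpoly_delta rmorphXn /= horner_mx_X -scalemxAl.
by rewrite companion_expr_delta mxE.
Qed.

Lemma horner_companion_e0 (p : {poly R}) : (size p <= m.+1)%N ->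
  horner_mx C p *m e0 = \col_i p`_i.
Proof.
move=> size_p; rewrite -[RHS]horner_rVpoly_e0.
have -> : (\col_(i < m.+1) p`_i)^T = poly_rV p by apply/rowP=> i; rewrite !mxE.
by rewrite poly_rV_K.
Qed.

(** It suffices to test on [e0], which [C ^+ m.+1] sends to the last column of [C]; this cancels the
    coefficients of f - X^(m+1). *)
Lemma horner_companion : f \is monic -> size f = m.+2 -> horner_mx C f = 0.
Proof.
move=> f_monic f_deg; apply: horner_companion_eq0.
have fE : f`_m.+1 = 1 by move/monicP: f_monic; rewrite lead_coefE f_deg.
have size_f : (size (f - 'X^(m.+1))%R <= m.+1)%N.
  apply/leq_sizeP => j; rewrite leq_eqVlt coefB coefXn => /predU1P[<-|lt_m_j].
    by rewrite eqxx fE subrr.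
  by rewrite (gtn_eqF lt_m_j) subr0 nth_default // f_deg.
rewrite -[X in horner_mx _ X](subrK 'X^(m.+1)) rmorphD mulmxDl /=.
rewrite horner_companion_e0 // rmorphXn /= horner_mx_X [C ^+ _]exprS.
rewrite -mulmxE -mulmxA.
have := companion_expr_delta ord_max; rewrite /= => ->; rewrite -colE.
apply/colP=> i; rewrite !mxE eqxx coefB coefXn ltn_eqF // subr0 addrN //.
Qed.
End Companion.

(** * The algebra generated by two companion matrices *)

Section TwoCompanions.
Variables (R : idomainType) (m : nat) (f g : {poly R}).
Hypotheses (f_monic : f \is monic) (f_deg : size f = m.+2).
Hypotheses (g_monic : g \is monic) (g_deg : size g = m.+2).
Local Notation C := (companion m.+1 f).
Local Notation D := (companion m.+1 g).
Local Notation e0 := (delta_mx 0 0 : 'cV[R]_m.+1).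
Local Notation H := (horner_mx C g).

Lemma horner_companion_sub : horner_mx C (g - f) = H.
Proof. by rewrite rmorphB /= horner_companion // subr0. Qed.

Lemma size_sub_monic : (size (g - f)%R <= m.+1)%N.
Proof.
apply/leq_sizeP => j; rewrite leq_eqVlt coefB => /predU1P[<-|lt_m_j].
  move/monicP: g_monic; move/monicP: f_monic.
  by rewrite !lead_coefE f_deg g_deg /= => -> ->; rewrite subrr.
by rewrite !nth_default ?subrr // ?f_deg ?g_deg.
Qed.

(** Only the last columns differ, by the coefficients of g - f, and these are the coordinates of (g
    - f)(C) e0 = H e0. *)
Lemma companion_sub : C - D = H *m delta_mx 0 ord_max.
Proof.
rewrite -(mul_delta_mx (0 : 'I_1)) mulmxA -horner_companion_sub.
rewrite horner_companion_e0 ?size_sub_monic //.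
apply/matrixP=> i j; rewrite !mxE big_ord1 !mxE eqxx /= -val_eqE /= eqSS coefB.
by case: eqP => _; rewrite ?mulr1 ?mulr0 ?subrr // opprK addrC.
Qed.

(* The polynomial part of [A], read off its first column. *)
Definition cyclic_part (A : 'M[R]_m.+1) : 'M[R]_m.+1 :=
  horner_mx C (rVpoly (col 0 A)^T).

Lemma cyclic_part_linear : linear cyclic_part.
Proof. by move=> a A B; rewrite /cyclic_part !linearP. Qed.
HB.instance Definition _ := GRing.isLinear.Build R _ _ _ cyclic_part
  cyclic_part_linear.

Lemma col_cyclic_part A : col 0 (cyclic_part A) = col 0 A.
Proof. by rewrite [LHS]colE horner_rVpoly_e0. Qed.

Lemma cyclic_part_eq0 A : col 0 A = 0 -> cyclic_part A = 0.
Proof. by rewrite /cyclic_part => ->; rewrite trmx0 linear0 rmorph0. Qed.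

Lemma cyclic_part_horner p : cyclic_part (horner_mx C p) = horner_mx C p.
Proof.
apply/eqP; rewrite -subr_eq0 -rmorphB; apply/eqP/horner_companion_eq0.
by rewrite rmorphB mulmxBl -!colE col_cyclic_part subrr.
Qed.

(** Both sides are polynomials in [C] with the same first column. *)
Lemma cyclic_part_mul p A :
  cyclic_part (horner_mx C p *m A) = horner_mx C p *m cyclic_part A.
Proof.
apply/eqP; rewrite -subr_eq0 mulmxE -rmorphM -rmorphB.
apply/eqP/horner_companion_eq0.
rewrite rmorphB rmorphM mulmxBl -mulmxE -mulmxA -!colE !col_cyclic_part.
by rewrite !colE mulmxA subrr.
Qed.

(** This is R[C] + H M_n(R). Fixing the polynomial part as [cyclic_part A] turns membership into a
    condition on each column of [A - cyclic_part A] separately. *)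
Definition cyclic_plus_multiple : set 'M[R]_m.+1 :=
  [set A | exists B, A - cyclic_part A = H *m B].

Lemma cyclic_plus_multipleP A :
  cyclic_plus_multiple A <-> exists p B, A = horner_mx C p + H *m B.
Proof.
split=> [[B AB]|[p [B ->]]].
  by exists (rVpoly (col 0 A)^T), B; rewrite -AB addrC subrK.
(* The cyclic part of p(C) + H B is p(C) + H [cyclic_part B]. *)
exists (B - cyclic_part B).
rewrite linearD /= cyclic_part_horner cyclic_part_mul mulmxBr.
by rewrite opprD addrACA subrr add0r.
Qed.

Lemma cyclic_plus_multiple_subalgebra : matrix_subalgebra cyclic_plus_multiple.
Proof.
split.
- apply/cyclic_plus_multipleP; exists 1, 0.
  by rewrite idmxE rmorph1 mulmx0 addr0.
- move=> a A B [A' AA'] [B' BB']; exists (a *: A' + B').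
  by rewrite linearP /= opprD addrACA -scalerBr AA' BB' mulmxDr scalemxAr.
- move=> _ _ /cyclic_plus_multipleP[p [A ->]] /cyclic_plus_multipleP[q [B ->]].
  apply/cyclic_plus_multipleP.
  exists (p * q), (A *m horner_mx C q + horner_mx C p *m B + A *m H *m B).
  rewrite mulmxDl !mulmxDr rmorphM -!mulmxE !mulmxA.
  rewrite [horner_mx C p *m H]horner_mxC.
  by rewrite -!addrA; congr (_ + _); rewrite addrCA.
Qed.

Lemma generated_subalgebraE : generated_subalgebra C D = cyclic_plus_multiple.
Proof.
apply/seteqP; split.
  have hC : cyclic_plus_multiple C.
    apply/cyclic_plus_multipleP; exists 'X, 0.
    by rewrite horner_mx_X mulmx0 addr0.
  apply: smallest_sub; first exact: cyclic_plus_multiple_subalgebra.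
  move=> _ [->|->] //; apply/cyclic_plus_multipleP.
  exists 'X, (- delta_mx 0 ord_max).
  by rewrite horner_mx_X mulmxN -companion_sub opprB addrC subrK.
move=> _ /cyclic_plus_multipleP[p [B ->]] S [[S1 SZD SM] SCD].
have SC : S C by apply: SCD; left.
have SD : S D by apply: SCD; right.
have S0 : S 0 by rewrite -[0](addNr 1%:M) -scaleN1r; exact: SZD.
have SAdd X Y : S X -> S Y -> S (X + Y).
  by move=> SX SY; rewrite -[X]scale1r; exact: SZD.
have SZ a X : S X -> S (a *: X).
  by move=> SX; rewrite -[_ *: _]addr0; exact: SZD.
have SP q : S (horner_mx C q).
  elim/poly_ind: q => [|q c IHq]; first by rewrite rmorph0.
  rewrite rmorphD rmorphM /= horner_mx_X horner_mx_C -scalemx1.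
  by apply: SAdd; [exact: SM | exact: SZ].
apply: (SAdd) => //.
have SHmul q X : S (H *m X) -> S (H *m (horner_mx C q *m X)).
  by move=> SX; rewrite mulmxA horner_mxC -mulmxA; exact: SM.
(* Multiplying C - D on the left by [C ^+ i], which commutes with [H], moves the unit of the last
   column from row 0 to row [i]. *)
have SHdelta_max i : S (H *m delta_mx i ord_max).
  rewrite -(mul_delta_mx (0 : 'I_1)) -(companion_expr_delta f).
  have -> : C ^+ i = horner_mx C 'X^i by rewrite rmorphXn /= horner_mx_X.
  rewrite -mulmxA mul_delta_mx; apply: SHmul.
  by rewrite -companion_sub -scaleN1r addrC; exact: SZD.
(* Descending induction on the column: row j+1 of [C] is e_j - f_(j+1) e_m, so right multiplication
   by [C] shifts column j+1 to [j], up to a multiple of the last column. *)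
have SHdelta i j : S (H *m delta_mx i j).
  have [k] := ubnP (m - j)%N; elim: k j => // k IHk j.
  have [->|j_max] := eqVneq j ord_max; first by [].
  have lt_j_m : (j < m)%N by rewrite ltn_neqAle -ltnS ltn_ord andbT.
  move=> mjk; pose j1 : 'I_m.+1 := Ordinal (lt_j_m : (j.+1 < m.+1)%N).
  have -> : delta_mx i j = delta_mx i j1 *m C + f`_j1 *: delta_mx i ord_max.
    rewrite -[delta_mx i j1](mul_delta_mx (0 : 'I_1)) -mulmxA -rowE.
    apply/matrixP=> r s; rewrite !mxE big_ord1 !mxE /= -!val_eqE /= !eqSS andbT.
    case: (r == i :> nat) => /=; last by rewrite !mulr0n mul0r mulr0 addr0.
    rewrite mul1r eq_sym.
    case: (eqVneq (nat_of_ord s) m) => [->|_]; last by rewrite mulr0 addr0.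
    by rewrite (ltn_eqF lt_j_m) mulr1 addNr.
  rewrite mulmxDr -scalemxAr; apply: SAdd; last exact: SZ.
  rewrite mulmxA; apply: SM => //; apply: IHk => /=; lia.
rewrite [B]matrix_sum_delta mulmx_sumr; elim/big_ind: _ => // i _.
rewrite mulmx_sumr; elim/big_ind: _ => // j _.
by rewrite -scalemxAr; exact: SZ.
Qed.
End TwoCompanions.

(** * The resultant as a determinant, the index and the rank *)

Section IndexAndRank.
Variables (R : idomainType) (m : nat) (f g : {poly R}).
Hypotheses (f_monic : f \is monic) (f_deg : size f = m.+2).
Hypotheses (g_monic : g \is monic) (g_deg : size g = m.+2).
Local Notation C := (companion m.+1 f).
Local Notation D := (companion m.+1 g).
Local Notation e0 := (delta_mx 0 0 : 'cV[R]_m.+1).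
Local Notation H := (horner_mx C g).
Local Notation S := (generated_subalgebra C D).
Local Notation cyclic_part := (cyclic_part f).

(* Multiplying the Sylvester matrix by the matrix of
   [P |-> (P %/ 'X^n, P(C) e0)], [deg P < 2 n], makes it block triangular,
   because [f(C) = 0]. *)
Lemma det_horner_companion :
  exists2 u, u \is a GRing.unit & \det H = resultant f g * u.
Proof.
pose band (p : {poly R}) : 'M[R]_(m.+1, m.+1 + m.+1) :=
  lin1_mx (poly_rV \o p \o* rVpoly).
have -> : resultant f g = \det (col_mx (band f) (band g)).
  (* The format of the Sylvester matrix is computed from the sizes of [f] and [g]; it is generalized
     so that both dimensions can become [m.+1]. *)
  suff resE a b : (size g).-1 = a -> (size f).-1 = b -> resultant f g =
      \det (col_mx (lin1_mx (poly_rV \o f \o* rVpoly) : 'M_(a, a + b))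
                   (lin1_mx (poly_rV \o g \o* rVpoly) : 'M_(b, a + b))).
    by apply: resE; rewrite ?f_deg ?g_deg.
  by move=> <- <-.
pose K : 'M[R]_(m.+1 + m.+1, m.+1) :=
  lin1_mx (trmx \o mulmxr e0 \o horner_mx C \o rVpoly).
have KE u : u *m K = (horner_mx C (rVpoly u) *m e0)^T by rewrite mul_rV_lin1.
have rowK (p : {poly R}) i : size p = m.+2 ->
    row i (band p *m K) = (horner_mx C p *m delta_mx i 0)^T.
  move=> p_deg; rewrite row_mul rowE KE mul_rV_lin1 /= rVpoly_delta.
  have p0 : p != 0 by rewrite -size_poly_gt0 p_deg.
  rewrite mulrC poly_rV_K; last first.
    rewrite size_mulXn // p_deg; have := ltn_ord i; lia.
  rewrite horner_companion_delta mulrC rmorphM rmorphXn /= horner_mx_X.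
  by rewrite -mulmxE mulmxA.
have fK : band f *m K = 0.
  apply/row_matrixP => i.
  by rewrite rowK // horner_companion // mul0mx trmx0 row0.
have gK : band g *m K = H^T.
  by apply/row_matrixP => i; rewrite rowK // -colE tr_col.
have uK : usubmx K = 1%:M.
  apply/row_matrixP => i; rewrite row_usubmx rowE KE rVpoly_delta rowE mulmx1.
  by rewrite rmorphXn /= horner_mx_X companion_expr_delta trmx_delta.
pose W : 'M[R]_(m.+1 + m.+1) := row_mx (col_mx 0 1%:M) K.
pose F := rsubmx (band f).
have F_coef i j : F i j = (f * 'X^i)`_(m.+1 + j).
  by rewrite !mxE /= rVpoly_delta mulrC.
(* The entry [F i j] is the coefficient of [f] of index m+1+j-i, so [F] is lower triangular with
   diagonal entries 1. *)
have detF : \det F = 1.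
  rewrite det_trig; last first.
    apply/is_trig_mxP => i j ij; rewrite F_coef coefMXn.
    case: ifP => // _; apply: nth_default; rewrite f_deg; lia.
  rewrite big1 // => i _; rewrite F_coef coefMXn ifN; last lia.
  by rewrite addnK; move/monicP: f_monic; rewrite lead_coefE f_deg.
have detSW : \det (col_mx (band f) (band g)) * \det W = \det H.
  rewrite -det_mulmx mul_col_row fK gK -[band f]hsubmxK mul_row_col mulmx0.
  by rewrite mulmx1 add0r det_lblock detF mul1r det_tr.
exists (\det W) => //; rewrite -unitmxE.
(* By [uK], [W] is [block_mx 0 1 1 (dsubmx K)], whose inverse is explicit. *)
suff /mulmx1_unit[] : W *m block_mx (- dsubmx K) 1%:M 1%:M 0 = 1%:M by [].
rewrite /W -{1}[K]vsubmxK uK -block_mxEh mulmx_block.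
by rewrite !(mul0mx, mulmx0, mul1mx, mulmx1, add0r, addr0) addNr
  -scalar_mx_block.
Qed.

Lemma det_horner_companion_neq0 : (\det H != 0) = (resultant f g != 0).
Proof.
have [u u_unit ->] := det_horner_companion.
by rewrite mulf_eq0 negb_or andbC; case: eqP u_unit => // ->; rewrite unitr0.
Qed.

Lemma generated_subalgebra_index :
  is_pid R -> (forall I : set R, maximal_ideal I -> finite_index I) ->
  resultant f g != 0 ->
  finite_index S /\ add_index S = (ideal_norm (resultant f g) ^ m)%N.
Proof.
move=> R_pid max_fin; rewrite -det_horner_companion_neq0 => H0.
have [T [phi [psi [q_phi q_psi]]]] := quotient_range_mulmx R_pid max_fin H0.
have -> : ideal_norm (resultant f g) = #|T|.
  have [u u_unit dE] := det_horner_companion.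
  rewrite /ideal_norm -(principal_ideal_unit _ u_unit) -dE.
  apply: (quotient_index _ q_psi).2.
  exact/ideal_subgroup/principal_ideal_ideal.
(* The first column of [A - cyclic_part A] is zero; the [m] others, taken modulo the range of [H],
   account for the exponent. *)
pose theta (A : 'M[R]_m.+1) : {ffun 'I_m -> T} :=
  [ffun j => phi (col (lift 0 j) (A - cyclic_part A))].
have -> : (#|T| ^ m)%N = #|{ffun 'I_m -> T}| by rewrite card_ffun card_ord.
apply: (@quotient_index _ _ _ theta);
  rewrite (generated_subalgebraE f_monic) //.
  have [S1 SZD _] := cyclic_plus_multiple_subalgebra m f g.
  split; first by rewrite -[0](addNr 1%:M) -scaleN1r; exact: SZD.
  by move=> x y Sx Sy; rewrite addrC -scaleN1r; exact: SZD.
split=> [t|x y].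
  have [v vE] : exists v : 'I_m -> 'cV[R]_m.+1, forall j, phi (v j) = t j.
    exists (fun j => projT1 (cid (q_phi.1 (t j)))) => j; by case: cid.
  (* A zero first column makes the cyclic part vanish, leaving the other columns free to be
     prescribed. *)
  pose A : 'M[R]_m.+1 :=
    \matrix_(i, k) if unlift 0 k is Some j then v j i 0 else 0.
  have A0 : col 0 A = 0 by apply/colP => i; rewrite !mxE unlift_none.
  exists A; apply/ffunP => j; rewrite ffunE -vE; congr phi.
  rewrite cyclic_part_eq0 // subr0.
  by apply/colP => i; rewrite !mxE liftK.
have -> : theta x = theta y <-> forall j : 'I_m,
    range (fun v : 'cV_m.+1 => H *m v)
      (col (lift 0 j) (x - y - cyclic_part (x - y))).
  have colB j :
      col (lift 0 j) (x - cyclic_part x) - col (lift 0 j) (y - cyclic_part y) =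
      col (lift 0 j) (x - y - cyclic_part (x - y)).
    by rewrite -raddfB [cyclic_part (x - y)]linearB /= !opprD addrACA.
  split=> [/ffunP e j|e].
    by have := e j; rewrite !ffunE q_phi.2 colB.
  by apply/ffunP => j; rewrite !ffunE q_phi.2 colB.
set z := x - y; split=> [e|[B zB] j]; last first.
  by exists (col (lift 0 j) B) => //; rewrite zB !colE mulmxA.
have [v vE] : exists v : 'I_m -> 'cV[R]_m.+1, forall j,
    H *m v j = col (lift 0 j) (z - cyclic_part z).
  have h j : exists w, H *m w = col (lift 0 j) (z - cyclic_part z).
    by have [w _ <-] := e j; exists w.
  exists (fun j => projT1 (cid (h j))) => j; by case: cid.
(* The columnwise preimages are assembled into one matrix, with first column 0 because that of
   [z - cyclic_part z] is 0. *)
exists (\matrix_(i, k) if unlift 0 k is Some j then v j i 0 else 0).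
apply/matrixP => i k; have [j ->|->] := unliftP 0 k.
  have /colP/(_ i) := vE j; rewrite !mxE => <-.
  by apply: eq_bigr => l _; rewrite !mxE liftK.
have := col_cyclic_part f z => /colP/(_ i); rewrite !mxE => ->; rewrite subrr.
by rewrite big1 // => l _; rewrite !mxE unlift_none mulr0.
Qed.

(** The endomorphism [Psi] keeps the polynomial part and multiplies the rest by [H]. Its image is
    the subalgebra and it is injective when det H is non-zero, so the matrix units are sent to a
    basis. *)
Lemma generated_subalgebra_free :
  resultant f g != 0 -> free_of_rank S (m.+1 ^ 2)%N.
Proof.
rewrite -det_horner_companion_neq0 => H0.
pose Psi A := cyclic_part A + H *m (A - cyclic_part A).
have Psi_linear : linear Psi.
  move=> a A B; rewrite /Psi linearP /= scalerDr addrACA; congr (_ + _).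
  by rewrite opprD addrACA -scalerBr mulmxDr scalemxAr.
have col_sub A : col 0 (A - cyclic_part A) = 0.
  by rewrite raddfB /= col_cyclic_part subrr.
pose PsiL := HB.pack_for {linear 'M[R]_m.+1 -> 'M[R]_m.+1} Psi
  (GRing.isLinear.Build R _ _ _ Psi Psi_linear).
have Psi_inj A : Psi A = 0 -> A = 0.
  (* The first column of [Psi A] is that of [A], which kills the cyclic part; the adjugate of [H]
     then cancels [H]. *)
  move=> A0; have A'0 : cyclic_part A = 0.
    apply: cyclic_part_eq0; move: (congr1 (col 0) A0).
    rewrite raddfD raddf0 /= col_cyclic_part [col 0 (_ *m _)]colE -mulmxA.
    by rewrite -colE col_sub mulmx0 addr0.
  move: A0; rewrite /Psi A'0 add0r subr0 => /(congr1 (mulmx (\adj H))).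
  rewrite mulmxA mul_adj_mx mulmx0 mul_scalar_mx => /eqP.
  by rewrite scalemx_eq0 (negPf H0) => /eqP.
have PsiE (c : 'rV[R]_(m.+1 * m.+1)) :
    \sum_i c 0 i *: Psi (vec_mx (delta_mx 0 i)) = Psi (vec_mx c).
  rewrite -[RHS]/(PsiL (vec_mx c)) [in RHS](row_sum_delta c) !linear_sum.
  by apply: eq_bigr => i _; rewrite linearZ [RHS]linearZ.
exists (fun i => Psi (vec_mx (delta_mx 0 i))); split; last first.
  move=> c; rewrite PsiE => /Psi_inj/(congr1 mxvec).
  by rewrite vec_mxK linear0.
rewrite (generated_subalgebraE f_monic) //; apply/seteqP; split=> A.
  (* [B] is corrected to have zero first column. This does not change H B: H [cyclic_part B] is the
     cyclic part of H B = [A - cyclic_part A], hence 0. *)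
  move=> [B AB]; pose X := cyclic_part A + (B - cyclic_part B).
  have cX : cyclic_part X = cyclic_part A.
    rewrite linearD /= [X in _ + X]cyclic_part_eq0 ?col_sub // addr0.
    exact: cyclic_part_horner.
  have HcB : H *m cyclic_part B = 0.
    by rewrite -cyclic_part_mul -AB cyclic_part_eq0.
  exists (mxvec X) => //; rewrite PsiE mxvecK /Psi cX /X.
  rewrite [X in _ *m X]addrC addKr.
  by rewrite mulmxBr HcB subr0 -AB addrC subrK.
move=> [c _ <-]; rewrite PsiE /Psi; apply/cyclic_plus_multipleP.
by exists (rVpoly (col 0 (vec_mx c))^T), (vec_mx c - cyclic_part (vec_mx c)).
Qed.

(* A left null vector [w] of [g(C)] yields linear forms vanishing on the
   subalgebra; these are non-zero because [cyclic_part] only depends on the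
   first column and there are others. *)
Lemma generated_subalgebra_not_free :
  (0 < m)%N -> free_of_rank S (m.+1 ^ 2)%N -> resultant f g != 0.
Proof.
move=> m_gt0 [b [SE b_free]]; rewrite -det_horner_companion_neq0.
apply/det0P => -[w w0 wH].
pose L : 'M[R]_(m.+1 * m.+1, m.+1) :=
  lin1_mx (mulmx w \o vec_mx) - lin1_mx (mulmx w \o cyclic_part \o vec_mx).
have LE u : u *m L = w *m (vec_mx u - cyclic_part (vec_mx u)).
  by rewrite !mulmxBr !mul_rV_lin1.
(* The rank being exactly [m.+1 ^ 2], this matrix is square; freeness of [b] makes its determinant
   non-zero, and M L = 0 then forces L = 0. *)
pose M : 'M[R]_(m.+1 * m.+1) := \matrix_i mxvec (b i).
have ML : M *m L = 0.
  apply/row_matrixP => i; rewrite row_mul rowK LE mxvecK row0.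
  have [B ->] : cyclic_plus_multiple f g (b i).
    rewrite -generated_subalgebraE // SE; exists (delta_mx 0 i) => //.
    rewrite (bigD1 i) //= big1 ?mxE ?eqxx ?scale1r ?addr0 // => j ij.
    by rewrite mxE (negPf ij) scale0r.
  by rewrite mulmxA wH mul0mx.
have M0 : \det M != 0.
  apply/det0P => -[c c0 cM]; case/eqP: c0; apply: b_free.
  apply: (can_inj mxvecK); rewrite linear0 linear_sum -[RHS]cM mulmx_sum_row.
  by apply: eq_bigr => i _; rewrite linearZ rowK.
have L0 : L = 0.
  apply: (scalemx_inj M0); rewrite scaler0 -mul_scalar_mx -mul_adj_mx -mulmxA.
  by rewrite ML mulmx0.
(* A column other than the first: the matrix units in it have cyclic part 0, so L = 0 makes every
   entry of [w] vanish. *)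
pose j : 'I_m.+1 := Ordinal (m_gt0 : (1 < m.+1)%N).
case/eqP: w0; apply/rowP => i.
have := LE (mxvec (delta_mx i j)); rewrite L0 mulmx0 mxvecK.
have -> : cyclic_part (delta_mx i j) = 0.
  by apply: cyclic_part_eq0; apply/colP => k; rewrite !mxE andbF.
rewrite subr0 => /rowP/(_ j); rewrite !mxE (bigD1 i) //= big1 ?addr0.
  by rewrite mxE !eqxx mulr1 => <-.
by move=> k ki; rewrite mxE (negPf ki) mulr0.
Qed.
End IndexAndRank.

Theorem theorem11p1 (R : idomainType) (n : nat) (f g : {poly R})
  (R_pid : is_pid R)
  (max_fin : forall I : set R, maximal_ideal I -> finite_index I)
  (n_ge2 : (2 <= n)%N)
  (f_monic : f \is monic) (f_deg : size f = n.+1)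
  (g_monic : g \is monic) (g_deg : size g = n.+1) :
  (free_of_rank (generated_subalgebra (companion n f) (companion n g))
     (n ^ 2)%N
   <-> resultant f g <> 0) /\
  (resultant f g <> 0 ->
     finite_index (generated_subalgebra (companion n f) (companion n g)) /\
     add_index (generated_subalgebra (companion n f) (companion n g))
       = (ideal_norm (resultant f g) ^ (n - 1))%N).
Proof.
case: n n_ge2 f_deg g_deg => // m m_gt0 f_deg g_deg.
rewrite subn1; split; [split=> [/generated_subalgebra_not_free|] |].
- by move=> res0; apply/eqP/res0.
- by move=> /eqP; apply: generated_subalgebra_free.
- by move=> /eqP; apply: generated_subalgebra_index.
Qed.
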